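(* Let $H^r(G)=H(\cdots H(G))$ denote the $r$-fold Hamming expansion of a graph $G$. Then for every integer $r\ge 1$, $H^r(h^3_e)$ corresponds to an ELC-preserved self-dual $[8\cdot 7^r,\,4\cdot 7^r,\,4]$ code, and $H^{r+1}(s^2)$ corresponds to an ELC-preserved self-dual $[2\cdot 7^{r+1},\,7^{r+1},\,4]$ code.
   Context: All graphs are finite, simple and undirected. For a graph $G=(V,E)$ and $v\in V$, $N_v$ is the set of vertices adjacent to $v$. Local complementation (LC) on $v$ transforms $G$ into $G*v$ by replacing the induced subgraph of $G$ on $N_v$ by its complement. For an edge $\{u,v\}\in E$, edge local complementation (ELC) on $\{u,v\}$ transforms $G$ into $G^{(u,v)}=G*u*v*u=G*v*u*v$ (operations applied from left to right). $G$ is ELC-preserved if for every edge $\{u,v\}\in E$, $G^{(u,v)}$ is isomorphic to $G$. $s^2$ is the graph with two vertices joined by an edge. $h^3_e$ is the bipartite graph on 8 vertices with one partition $U\cup\{x\}$, $U=\{u_1,u_2,u_3\}$, and the other partition consisting of four vertices: three vertices each adjacent to $x$ and to exactly two vertices of $U$ (one for each 2-subset of $U$), and one vertex adjacent to $u_1,u_2,u_3$ but not to $x$. Hamming expansion: let $G=(V,E)$ with $V=\{v_0,\dots,v_{k-1}\}$. $H(G)$ is the graph on the $7k$ vertices $w_0,\dots,w_{7k-1}$ constructed as follows. For each $0\le i<k$, the vertex $v_i$ is replaced by the subgraph $h_i$ with vertices $\{w_{7i},\dots,w_{7i+6}\}$ and edges $\{w_{7i},w_{7i+3}\}$, $\{w_{7i},w_{7i+4}\}$,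 $\{w_{7i+1},w_{7i+3}\}$, $\{w_{7i+1},w_{7i+5}\}$, $\{w_{7i+2},w_{7i+4}\}$, $\{w_{7i+2},w_{7i+5}\}$, $\{w_{7i+3},w_{7i+6}\}$, $\{w_{7i+4},w_{7i+6}\}$, $\{w_{7i+5},w_{7i+6}\}$. If $\{v_i,v_j\}\in E$, each of $w_{7i},w_{7i+1},w_{7i+2}$ is joined to all of $w_{7j},w_{7j+1},w_{7j+2}$. There are no other edges. An $[n,k,d]$ code is a $k$-dimensional subspace of $\mathbb{F}_2^n$ with minimum distance $d$; two codes are equivalent if one is obtained from the other by a permutation of coordinates. A code $\mathcal{C}$ is self-dual if $\mathcal{C}=\mathcal{C}^\perp$ with respect to the standard inner product. A bipartite graph corresponds to an $[n,k]$ code $\mathcal{C}$ if it is isomorphic to the $(k,n-k)$-bipartite graph with adjacency matrix $\begin{pmatrix}\mathbf{0}_{k\times k}&P\\P^{\mathrm T}&\mathbf{0}_{(n-k)\times(n-k)}\end{pmatrix}$ for some generator matrix $(I\mid P)$ of a code equivalent to $\mathcal{C}$. An ELC-preserved code is a binary linear code corresponding to an ELC-preserved bipartite graph. *)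

(* Defs.v *)
From mathcomp Require Import all_boot all_order all_algebra all_fingroup.

Set Implicit Arguments.
Unset Strict Implicit.
Unset Printing Implicit Defensive.

Import GRing.Theory.
Local Open Scope ring_scope.

Record sgraph := SGraph {
  vertex :> finType;
  adj : rel vertex;
  adj_sym : symmetric adj;
  adj_irr : irreflexive adj
}.

Definition graph_iso (G H : sgraph) : Prop :=
  exists f : G -> H, bijective f /\ forall x y, adj (f x) (f y) = adj x y.

Definition bipartite (G : sgraph) : Prop :=
  exists A : {set G}, forall x y, adj x y -> (x \in A) != (y \in A).

Definition lc_rel (G : sgraph) (v : G) : rel G :=
  fun x y => adj x y (+) [&& x != y, adj v x & adj v y].

Lemma lc_rel_sym (G : sgraph) (v : G) : symmetric (lc_rel v).
Proof. by move=> x y; rewrite /lc_rel adj_sym eq_sym [adj v x && _]andbC. Qed.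

Lemma lc_rel_irr (G : sgraph) (v : G) : irreflexive (lc_rel v).
Proof. by move=> x; rewrite /lc_rel adj_irr eqxx. Qed.

Definition lc (G : sgraph) (v : G) : sgraph :=
  SGraph (@lc_rel_sym G v) (@lc_rel_irr G v).

(** [G * u * v * u]; all three graphs share the vertex type of [G].  On an edge
    this also equals [G * v * u * v]. *)
Definition elc (G : sgraph) (u v : G) : sgraph :=
  @lc (@lc (@lc G u) v) u.

Definition elc_preserved (G : sgraph) : Prop :=
  forall u v : G, adj u v -> graph_iso (elc u v) G.

(** The edges are listed once each, as unordered pairs. *)
Definition edges_rel (n : nat) (s : seq (nat * nat)) : rel 'I_n :=
  fun i j => (i != j) &&
    (((i : nat, j : nat) \in s) || ((j : nat, i : nat) \in s)).

Lemma edges_rel_sym n s : symmetric (@edges_rel n s).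
Proof. by move=> i j; rewrite /edges_rel eq_sym orbC. Qed.

Lemma edges_rel_irr n s : irreflexive (@edges_rel n s).
Proof. by move=> i; rewrite /edges_rel eqxx. Qed.

Definition graph_of_edges (n : nat) (s : seq (nat * nat)) : sgraph :=
  SGraph (@edges_rel_sym n s) (@edges_rel_irr n s).

Definition s2 : sgraph := graph_of_edges 2 [:: (0, 1)]%N.

(** Vertices 0, 1, 2 are [u_1], [u_2], [u_3] and 3 is [x]; 4, 5, 6 are the
    vertices attached to [x] and a 2-subset of the [u_i]; 7 is the vertex
    attached to all [u_i]. *)
Definition h3e : sgraph :=
  graph_of_edges 8
    [:: (3, 4); (0, 4); (1, 4);
        (3, 5); (0, 5); (2, 5);
        (3, 6); (1, 6); (2, 6);
        (0, 7); (1, 7); (2, 7)]%N.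

Definition hamming_cell : sgraph :=
  graph_of_edges 7
    [:: (0, 3); (0, 4); (1, 3); (1, 5); (2, 4); (2, 5);
        (3, 6); (4, 6); (5, 6)]%N.

(** The pair [(v_i, j)] stands for the vertex [w_(7i+j)], so that no
    enumeration of the vertices of [G] has to be fixed. *)
Definition hamming_rel (G : sgraph) : rel (G * 'I_7)%type :=
  fun w z =>
    if w.1 == z.1 then @adj hamming_cell w.2 z.2
    else [&& adj w.1 z.1, (w.2 < 3)%N & (z.2 < 3)%N].

Lemma hamming_rel_sym G : symmetric (@hamming_rel G).
Proof.
move=> w z; rewrite /hamming_rel eq_sym [adj w.1 _]adj_sym.
by rewrite [@adj hamming_cell _ _]adj_sym [((w.2 < 3) && _)%N]andbC.
Qed.

Lemma hamming_rel_irr G : irreflexive (@hamming_rel G).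
Proof. by move=> w; rewrite /hamming_rel eqxx adj_irr. Qed.

Definition hamming_expansion (G : sgraph) : sgraph :=
  SGraph (@hamming_rel_sym G) (@hamming_rel_irr G).

Notation code n := {vspace 'rV['F_2]_n}.

Definition hamming_dist (n : nat) (x y : 'rV['F_2]_n) : nat :=
  #|[set i | x 0 i != y 0 i]|.

Definition min_distance (n : nat) (C : code n) (d : nat) : Prop :=
  (exists x y, [/\ x \in C, y \in C, x != y & hamming_dist x y = d]) /\
  (forall x y, x \in C -> y \in C -> x != y -> (d <= hamming_dist x y)%N).

Definition nkd_code (n k d : nat) (C : code n) : Prop :=
  \dim C = k /\ min_distance C d.

Definition dual_code (n : nat) (C : code n) : {set 'rV['F_2]_n} :=
  [set x : 'rV['F_2]_n |
    [forall y : 'rV['F_2]_n, (y \in C) ==> (\sum_i x 0 i * y 0 i == 0)]].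

Definition self_dual (n : nat) (C : code n) : Prop := C =i dual_code C.

Definition code_equiv (n : nat) (C D : code n) : Prop :=
  exists s : 'S_n, forall x : 'rV['F_2]_n, (x \in C) = (col_perm s x \in D).

Definition generator_matrix (n k : nat) (A : 'M['F_2]_(k, n)) (C : code n) :
    Prop :=
  row_free A /\ forall x : 'rV['F_2]_n, (x \in C) = (x <= A)%MS.

Definition bip_mx (k m : nat) (P : 'M['F_2]_(k, m)) : 'M['F_2]_(k + m) :=
  block_mx 0 P P^T 0.

Definition bip_rel (k m : nat) (P : 'M['F_2]_(k, m)) : rel 'I_(k + m) :=
  fun i j => bip_mx P i j == 1.

Lemma bip_rel_sym k m (P : 'M['F_2]_(k, m)) : symmetric (bip_rel P).
Proof.
move=> i j; rewrite /bip_rel -[in LHS](_ : (bip_mx P)^T = bip_mx P) ?mxE //.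
by rewrite /bip_mx tr_block_mx !trmx0 trmxK.
Qed.

Lemma bip_rel_irr k m (P : 'M['F_2]_(k, m)) : irreflexive (bip_rel P).
Proof.
by move=> i; rewrite /bip_rel /bip_mx; case: (split_ordP i) => j ->;
  rewrite ?block_mxEul ?block_mxEdr mxE.
Qed.

Definition bip_graph (k m : nat) (P : 'M['F_2]_(k, m)) : sgraph :=
  SGraph (@bip_rel_sym k m P) (@bip_rel_irr k m P).

(** The cast only identifies the lengths [k + m] and [n]; the number [k] of rows
    is necessarily the dimension of [C]. *)
Definition corresponds (n : nat) (G : sgraph) (C : code n) : Prop :=
  bipartite G /\
  exists (k m : nat) (kmn : (k + m = n)%N) (P : 'M['F_2]_(k, m)) (D : code n),
    [/\ code_equiv C D,
        generator_matrix (castmx (erefl k, kmn) (row_mx 1%:M P)) D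
      & graph_iso G (bip_graph P)].

Definition elc_preserved_code (n : nat) (C : code n) : Prop :=
  exists G : sgraph, [/\ bipartite G, elc_preserved G & corresponds G C].

(* Main.v *)
Require Import Defs.
From mathcomp Require Import all_boot all_order all_algebra all_fingroup.

Set Implicit Arguments.
Unset Strict Implicit.
Unset Printing Implicit Defensive.

Import GRing.Theory.
Local Open Scope ring_scope.

(** Let [B] be the adjacency matrix of a graph over [F_2].  Call the graph
    orthogonal when [B ^+ 2 = 1]; for a bipartite graph with blocks [P] and
    [P^T] this says [P *m P^T = 1%:M], so the two parts have the same size and
    the code generated by [(1 | P)] is self-dual.  The proof shows that being
    bipartite, orthogonal and ELC-preserved passes from [G] to its Hamming
    expansion, checks the three properties for the two starting graphs, and
    reads the parameters of the code off the degrees.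

    ELC on an edge [u v] has a closed form ([elcE]): over [F_2] it adds
    [N[u] x * N[v] y + N[v] x * N[u] y] to the adjacency of [x] and [y], where
    [N[_]] is the indicator of a closed neighbourhood.

    Orthogonality alone settles every edge with an end [v] of degree 3
    ([elc_iso_degree3]).  If [v] has neighbours [u], [c], [d], then column [v]
    of [B ^+ 2 = 1] says that [c] and [d] have the same neighbours up to the
    neighbourhood of [u] and [v] itself; so the complementation performed by ELC
    on [u v] merely exchanges [c] and [d].  This covers all edges of [h3e] and,
    in a Hamming expansion, all edges inside a cell, since each of them ends in
    a cell vertex of degree 3.

    Write [C] for the adjacency matrix of the seven-vertex cell, [o] for the
    indicator of its three outer vertices and [A] for the adjacency matrix of
    [G].  The expansion has matrix [1 (x) C + A (x) o o^T], so its orthogonality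
    follows from [A ^+ 2 = 1], [C ^+ 2 + o o^T = 1], [C o = 0] and [o^T o = 1]
    ([expansion_orthogonal]).  An edge between two cells joins outer vertices
    [(i, a)] and [(j, b)].  ELC on it exchanges, in cells [i] and [j], the
    outer triple with the closed neighbourhood of [a], respectively [b], in its
    cell, and the cell has a permutation undoing this exchange ([cell_pivot]).
    The result is thus the expansion of [elc i j] ([elc_expansion_outer]), which
    is isomorphic to the expansion of [G] when [G] is ELC-preserved.

    A word of the self-dual code has even weight, and a nonzero word
    [(a, a P)] has weight at least 2 because [P] is invertible.  Weight 2 would
    make some row of [P] a unit vector, that is, give a vertex of degree 1;
    there is none in an expansion.  A vertex of degree 3 gives a word of
    weight 4. *)

(** * Closed form of edge local complementation *)

Ltac bool_leaves := repeat match goal with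
  | |- context [@adj ?G ?x ?y] => case: (@adj G x y)
  | |- context [?x == ?y] => case: (x == y)
  end.

Definition closed_nbr (G : sgraph) (v x : G) : bool := (x == v) || adj v x.

(** The vertices outside [{u, v}] fall into classes according to their adjacency
    to [u] and [v], and ELC complements between any two different classes other
    than that of the common non-neighbours, which is where the [2 x 2]
    determinant of the adjacencies is nonzero.  Using closed neighbourhoods
    makes the same determinant account for the exchange of [u] and [v]. *)
Lemma elcE (G : sgraph) (u v x y : G) : adj u v ->
  @adj (elc u v) x y =
    adj x y (+) (closed_nbr u x && closed_nbr v y)
            (+) (closed_nbr v x && closed_nbr u y).
Proof.
move=> uv; have vu : adj v u by rewrite adj_sym.
have uNv : u == v = false by apply: contraTF uv => /eqP->; rewrite adj_irr.
rewrite /= /lc_rel /= /lc_rel /= /lc_rel /closed_nbr.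
have [->|xu] := eqVneq x u; [|have [->|xv] := eqVneq x v];
  (have [->|_] := eqVneq y u; [|have [->|_] := eqVneq y v]);
  rewrite ?(adj_irr, eqxx, uNv, uv, vu) 1?[v == u]eq_sym ?uNv /=
          ?[adj x u]adj_sym ?[adj x v]adj_sym; try by bool_leaves.
- by rewrite (negPf xu); bool_leaves.
- by rewrite (negPf xv); bool_leaves.
by have [->|_] := eqVneq x y; rewrite ?adj_irr; bool_leaves.
Qed.

(** * Orthogonal graphs and their vertices of degree 3 *)

(** The adjacency matrix over [F_2] is its own inverse; for bipartite graphs
    this is self-duality of the associated codes. *)
Definition orthogonal_graph (G : sgraph) : Prop :=
  forall x y : G, \big[addb/false]_z (adj x z && adj z y) = (x == y).

Definition nbrs (G : sgraph) (v : G) : {set G} := [set x | adj v x].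

Lemma graph_iso_sym (G H : sgraph) : graph_iso G H -> graph_iso H G.
Proof.
case=> f [[g fK gK] fadj]; exists g; split; first by exists f.
by move=> x y; rewrite -fadj !gK.
Qed.

Lemma graph_iso_trans (G H K : sgraph) :
  graph_iso G H -> graph_iso H K -> graph_iso G K.
Proof.
case=> f [fbij fadj] [g [gbij gadj]]; exists (g \o f); split.
  exact: bij_comp gbij fbij.
by move=> x y; rewrite /= gadj fadj.
Qed.

Lemma elc_sym (G : sgraph) (u v : G) : adj u v ->
  graph_iso (elc u v) (elc v u).
Proof.
move=> uv; exists id; split; first by exists id.
move=> x y; rewrite (elcE _ _ uv) elcE; last by rewrite adj_sym.
exact: addbAC.
Qed.

Lemma orthogonal_nbrs_sum (G : sgraph) (v x : G) : orthogonal_graph G ->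
  \big[addb/false]_(z in nbrs v) adj z x = (x == v).
Proof.
move=> orthG; rewrite eq_sym -orthG big_mkcond; apply: eq_bigr => z _.
by rewrite inE; case: (adj v z).
Qed.

(** Let [c], [d] be the other neighbours of [v].  Orthogonality gives
    [N_u + N_c + N_d = {v}] modulo 2, so complementing between [N_u] and
    [{c, d}] exchanges the neighbourhoods of [c] and [d].  The isomorphism is
    therefore the product of the transpositions of [u], [v] (made by every ELC)
    and of [c], [d]. *)
Lemma elc_iso_degree3 (G : sgraph) (u v : G) : orthogonal_graph G -> adj u v ->
  #|nbrs v| = 3%N -> graph_iso (elc u v) G.
Proof.
move=> orthG uv degv.
have: #|nbrs v :\ u| = 2%N.
  by move: degv; rewrite (cardsD1 u) inE adj_sym uv => -[].
move/eqP/cards2P=> [c [d [cd Ecd]]].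
have Nv x : adj v x = [|| x == u, x == c | x == d].
  have := setD1K (_ : u \in nbrs v); rewrite inE adj_sym uv => /(_ isT) ENv.
  by have := in_set (adj v) x; rewrite -/(nbrs v) -ENv Ecd !inE => <-.
have /setD1P[cNu _] : c \in nbrs v :\ u by rewrite Ecd set21.
have /setD1P[dNu _] : d \in nbrs v :\ u by rewrite Ecd set22.
have sumN x : adj u x (+) adj c x (+) adj d x = (x == v).
  rewrite -(orthogonal_nbrs_sum v x orthG) (big_setD1 u) ?inE 1?adj_sym ?uv //=.
  by rewrite Ecd big_setU1 ?inE // big_set1 addbA ![adj x _]adj_sym.
have vNu : v != u by apply: contraTneq uv => ->; rewrite adj_irr.
have [vNc vNd] : v != c /\ v != d.
  by split; [have := Nv c|have := Nv d]; rewrite eqxx ?orbT;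
     apply: contraTneq => <-; rewrite adj_irr.
have [uNc uNd] : u != c /\ u != d by rewrite ![u == _]eq_sym.
apply: graph_iso_sym.
pose f x := tperm u v (tperm c d x).
exists f; split.
  by exists (fun x => tperm c d (tperm u v x)) => x; rewrite /f !tpermK.
have fu : f u = v by rewrite /f [tperm c d u]tpermD ?tpermL.
have fv : f v = u by rewrite /f [tperm c d v]tpermD ?tpermR // eq_sym.
have fc : f c = d by rewrite /f tpermL tpermD.
have fd : f d = c by rewrite /f tpermR tpermD.
have fo x : x != u -> x != v -> x != c -> x != d -> f x = x.
  move=> xu xv xc xd; rewrite /f [tperm c d x]tpermD 1?eq_sym //.
  by rewrite tpermD 1?eq_sym.
(* The four vertices induce either a star or a complete graph. *)
have cdE : adj c d = adj u c.
  move: (sumN c); rewrite adj_irr [c == v]eq_sym (negPf vNc) addbF.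
  by rewrite [adj d c]adj_sym; case: (adj u c); case: (adj c d).
have udE : adj u d = adj u c.
  move: (sumN u); rewrite adj_irr [u == v]eq_sym (negPf vNu) ![adj _ u]adj_sym.
  by case: (adj u c); case: (adj u d).
have [vu vc vd] : [/\ adj v u, adj v c & adj v d] by rewrite !Nv !eqxx !orbT.
have [cv dv] : adj c v /\ adj d v by rewrite ![adj _ v]adj_sym.
have closed_v x : closed_nbr v x = [|| x == v, x == u, x == c | x == d].
  by rewrite /closed_nbr Nv.
have far x y : x != u -> x != v -> x != c -> x != d ->
    @adj (elc u v) (f x) (f y) = adj x y.
  move=> xu xv xc xd; rewrite fo // elcE // !closed_v /closed_nbr.
  have xvF : adj x v = false.
    by rewrite adj_sym Nv (negPf xu) (negPf xc) (negPf xd).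
  have sumx : adj x d = adj x u (+) adj x c.
    by move: (sumN x); rewrite (negPf xv) ![adj _ x]adj_sym;
      case: (adj x u); case: (adj x c); case: (adj x d).
  rewrite (negPf xu) (negPf xv) (negPf xc) (negPf xd) /= addbF [adj u x]adj_sym.
  have [->|yu] := eqVneq y u.
    by rewrite fu eqxx andbT xvF.
  have [->|yv] := eqVneq y v.
    by rewrite fv eqxx orbT andbT xvF addbb.
  have [->|yc] := eqVneq y c.
    by rewrite fc eqxx !orbT andbT sumx; case: (adj x u); case: (adj x c).
  have [->|yd] := eqVneq y d.
    by rewrite fd eqxx !orbT andbT sumx; case: (adj x u); case: (adj x c).
  by rewrite fo // (negPf yu) (negPf yv) (negPf yc) (negPf yd) andbF addbF.
move=> x y.
have [xo|] := boolP [&& x != u, x != v, x != c & x != d].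
  by case/and4P: xo => *; apply: far.
have [yo _|] := boolP [&& y != u, y != v, y != c & y != d].
  by rewrite adj_sym [RHS]adj_sym; case/and4P: yo => *; apply: far.
have neqs := (negPf vNu, negPf vNc, negPf vNd, negPf uNc, negPf uNd, negPf cNu,
  negPf dNu, negPf cd).
have [cNv dNv dNc uNv] : [/\ c == v = false, d == v = false, d == c = false
    & u == v = false].
  by rewrite ![_ == v]eq_sym [d == c]eq_sym !neqs.
rewrite !negb_and !negbK.
by case/or4P=> /eqP-> /or4P[] /eqP->; rewrite ?(fu, fv, fc, fd) elcE //
     /closed_nbr ?[adj c u]adj_sym ?[adj d u]adj_sym ?[adj d c]adj_sym
     ?(eqxx, adj_irr, neqs, cNv, dNv, dNc, uNv, vu, vc, vd, cv, dv, uv, udE,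
       cdE)
     ?orbT /=; case: (adj u c).
Qed.

(** * Deciding finite graph identities on natural numbers *)

(** The relation of [graph_of_edges] without the bound on the vertices, so that
    statements about small graphs reduce to evaluating lists of numbers. *)
Definition edge_in (s : seq (nat * nat)) (i j : nat) : bool :=
  (i != j) && (((i, j) \in s) || ((j, i) \in s)).

Lemma all_ordP n (p : pred nat) : all p (iota 0 n) -> forall i : 'I_n, p i.
Proof. by move=> /allP pP i; apply: pP; rewrite mem_iota ltn_ord. Qed.

Lemma all_ord2P n (p : nat -> nat -> bool) :
  all (fun i => all (p i) (iota 0 n)) (iota 0 n) -> forall i j : 'I_n, p i j.
Proof. by move=> pP i; apply/all_ordP/(all_ordP pP). Qed.

Lemma xor_ord n (p : pred nat) :
  \big[addb/false]_(k < n) p k = foldr (fun k => addb (p k)) false (iota 0 n).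
Proof. by rewrite -(big_mkord xpredT) unlock /index_iota subn0. Qed.

(** * The cell of the Hamming expansion *)

Definition cell_rel : nat -> nat -> bool :=
  edge_in [:: (0, 3); (0, 4); (1, 3); (1, 5); (2, 4); (2, 5);
              (3, 6); (4, 6); (5, 6)]%N.

Definition outer (k : nat) : bool := (k < 3)%N.

(** One side of the bipartition of the cell; these vertices have degree 3 in every
    expansion. *)
Definition middle (k : nat) : bool := (2 < k < 6)%N.

Lemma cell_rel_sym i j : cell_rel i j = cell_rel j i.
Proof. by rewrite /cell_rel /edge_in eq_sym orbC. Qed.

(** The exclusive or loses nothing, as [adj p p] is false; it writes the adjacency
    matrix as [1 (x) C + A (x) o o^T]. *)
Lemma adj_expansion (G : sgraph) (p q : G) (x y : 'I_7) :
  @adj (hamming_expansion G) (p, x) (q, y) =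
    ((p == q) && cell_rel x y) (+) [&& adj p q, outer x & outer y].
Proof.
rewrite /= /hamming_rel /=; have [->|_] //= := eqVneq p q.
by rewrite adj_irr addbF.
Qed.

(** Two outer vertices have one common neighbour in their cell, so the cell alone
    is not orthogonal; the defect [o o^T] is repaired by the odd number of
    neighbouring cells. *)
Lemma cell_square (x y : 'I_7) :
  \big[addb/false]_(k < 7) (cell_rel x k && cell_rel k y)
    = (x == y) (+) (outer x && outer y).
Proof.
rewrite (xor_ord _ (fun k => cell_rel x k && cell_rel k y)); apply/eqP.
by apply: (@all_ord2P 7 (fun x y =>
  foldr (fun k => addb (cell_rel x k && cell_rel k y)) false (iota 0 7)
    == (x == y) (+) (outer x && outer y))).
Qed.

Lemma cell_outer (x : 'I_7) :
  \big[addb/false]_(k < 7) (cell_rel x k && outer k) = false.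
Proof.
rewrite (xor_ord _ (fun k => cell_rel x k && outer k)); apply/eqP.
by apply: (@all_ordP 7 (fun x =>
  foldr (fun k => addb (cell_rel x k && outer k)) false (iota 0 7) == false)).
Qed.

Lemma outer_odd : \big[addb/false]_(k < 7) outer k = true.
Proof. by rewrite xor_ord. Qed.

(** Squaring [1 (x) C + A (x) o o^T] gives
    [1 (x) C^2 + A (x) (C o o^T + o (C o)^T) + A^2 (x) o (o^T o) o^T]; the mixed
    terms vanish by [cell_outer] and the last one is [1 (x) o o^T]. *)
Lemma expansion_orthogonal (G : sgraph) :
  orthogonal_graph G -> orthogonal_graph (hamming_expansion G).
Proof.
move=> orthG [p x] [q y].
transitivity (\big[addb/false]_(r : G) \big[addb/false]_(k < 7)
   (((((p == r) && (r == q)) && (cell_rel x k && cell_rel k y)) (+)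
     ([&& p == r, adj r q & outer y] && (cell_rel x k && outer k))) (+)
    (([&& r == q, adj p r & outer x] && (cell_rel y k && outer k)) (+)
     ([&& adj p r, adj r q, outer x & outer y] && outer k)))).
  rewrite pair_bigA; apply: eq_bigr => -[r k] _.
  rewrite !adj_expansion [cell_rel y k]cell_rel_sym /=.
  by case: (p == r); case: (r == q); case: (adj p r); case: (adj r q);
    case: (outer x); case: (outer y); case: (outer k);
    case: (cell_rel x k); case: (cell_rel k y).
transitivity (\big[addb/false]_(r : G)
   ((p == r) && ((p == q) && ((x == y) (+) (outer x && outer y))) (+)
   ((adj p r && adj r q) && (outer x && outer y)))).
  apply: eq_bigr => r _; rewrite !big_split /=.
  rewrite -!big_distrr /= cell_square !cell_outer outer_odd !andbF !andbT.
  by rewrite addbF /= -!andbA; have [->|] := eqVneq p r.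
rewrite big_split /= -!big_distrl /= orthG.
rewrite (bigD1 p) //= big1 ?eqxx => [|r /negPf]; last by rewrite eq_sym.
by rewrite xpair_eqE; case: (p == q); case: (x == y); case: (outer x);
  case: (outer y).
Qed.

(** * Isomorphisms and bipartitions of expansions *)

Lemma expansion_iso (G K : sgraph) :
  graph_iso G K -> graph_iso (hamming_expansion G) (hamming_expansion K).
Proof.
case=> f [[g fK gK] fadj]; exists (fun w => (f w.1, w.2)); split.
  by exists (fun w => (g w.1, w.2)) => -[p x] /=; rewrite ?fK ?gK.
by move=> [p x] [q y]; rewrite !adj_expansion fadj (can_eq fK).
Qed.

(** The middle vertices of a cell take the side opposite to that of the vertex
    replaced by the cell, the other vertices of the cell take the same side. *)
Lemma expansion_bipartite (G : sgraph) :
  bipartite G -> bipartite (hamming_expansion G).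
Proof.
case=> A bipA; exists [set w : G * 'I_7 | (w.1 \in A) (+) middle w.2].
move=> [p x] [q y]; rewrite adj_expansion !inE /=.
have [<- /=|_ /=] := eqVneq p q; last first.
  have outer_middle k : outer k -> middle k = false.
    by rewrite /outer /middle ltnS [(2 < k)%N]ltnNge => ->.
  by case/and3P=> /bipA pq /outer_middle-> /outer_middle->; rewrite !addbF.
rewrite adj_irr addbF => xy.
suff: middle x != middle y.
  by case: (p \in A); case: (middle x); case: (middle y).
apply: (implyP _ xy); move: x y {xy}.
exact: (@all_ord2P 7 (fun x y => cell_rel x y ==> (middle x != middle y))).
Qed.

(** * Edge local complementation between two cells *)

Definition cell_closed_nbr (a x : nat) : bool := (x == a) || cell_rel a x.

(** Join the outer vertices to an eighth vertex; the result is [h3e], and ELC on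
    the edge from [a] to the new vertex adds to the adjacency in the cell the
    terms in the last equation and gives the new vertex the neighbourhood
    [N[a]].  As [h3e] is ELC-preserved there is an isomorphism back to it; [r]
    is one that keeps the new vertex fixed. *)
Lemma cell_pivot (a : 'I_7) : outer a -> exists r : 'I_7 -> 'I_7,
  [/\ bijective r,
      forall x, outer (r x) = cell_closed_nbr a x,
      forall x, cell_closed_nbr a (r x) = outer x
    & forall x y, cell_rel (r x) (r y) = cell_rel x y
        (+) (outer x && cell_closed_nbr a y)
        (+) (cell_closed_nbr a x && outer y)].
Proof.
move=> a3.
pose pivots (a : nat) (s : seq nat) (x y : nat) := let r := nth 0%N s in
  [&& (r x < 7)%N, (r x == r y) ==> (x == y),
      outer (r x) == cell_closed_nbr a x, cell_closed_nbr a (r x) == outer x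
    & cell_rel (r x) (r y) == cell_rel x y (+) (outer x && cell_closed_nbr a y)
                                (+) (cell_closed_nbr a x && outer y)].
(* [s] lists the values of [r]. *)
have [s pivots_s] : exists s, forall x y : 'I_7, pivots a s x y.
  case: a a3 => -[|[|[|//]]] ? _;
    [ exists [:: 0; 3; 4; 2; 1; 6; 5]%N
    | exists [:: 3; 1; 5; 2; 6; 0; 4]%N
    | exists [:: 4; 5; 2; 6; 1; 0; 3]%N ];
    exact: (all_ord2P (p := pivots _ _)).
have s7 (x : 'I_7) : (nth 0%N s x < 7)%N by case/and5P: (pivots_s x x).
exists (fun x => Ordinal (s7 x)); split.
- apply: injF_bij => x y [] exy; apply/eqP.
  by case/and5P: (pivots_s x y) => _ /implyP/(_ (introT eqP exy)).
- by move=> x; case/and5P: (pivots_s x x) => _ _ /eqP.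
- by move=> x; case/and5P: (pivots_s x x) => _ _ _ /eqP.
by move=> x y; case/and5P: (pivots_s x y) => _ _ _ _ /eqP.
Qed.

Lemma closed_nbr_expansion (G : sgraph) (i p : G) (a x : 'I_7) : outer a ->
  @closed_nbr (hamming_expansion G) (i, a) (p, x) =
    if p == i then cell_closed_nbr a x else adj i p && outer x.
Proof.
move=> a3; rewrite /closed_nbr adj_expansion a3 /cell_closed_nbr xpair_eqE.
rewrite [i == p]eq_sym; have [->|_] //= := eqVneq p i.
by rewrite adj_irr addbF.
Qed.

Ltac cell_leaves := bool_leaves; repeat match goal with
  | |- context [outer ?x] => case: (outer x)
  | |- context [cell_closed_nbr ?a ?x] => case: (cell_closed_nbr a x)
  | |- context [cell_rel ?x ?y] => case: (cell_rel x y)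
  end.

(** After ELC the vertices attached to the other cells are those of [N[a]] in cell
    [i] and of [N[b]] in cell [j]; the cells are attached to each other and to
    the rest as [elc i j] prescribes.  The permutations of [cell_pivot] in these
    two cells bring them back to standard form, and all remaining terms of
    [elcE] cancel in pairs. *)
Lemma elc_expansion_outer (G : sgraph) (i j : G) (a b : 'I_7) :
    adj i j -> outer a -> outer b ->
  graph_iso (@elc (hamming_expansion G) (i, a) (j, b))
            (hamming_expansion (elc i j)).
Proof.
move=> ij a3 b3; apply: graph_iso_sym.
have ji : adj j i by rewrite adj_sym.
have iNj : (i == j) = false by apply: contraTF ij => /eqP->; rewrite adj_irr.
have jNi : (j == i) = false by rewrite eq_sym.
have [ra [[ra' raK ra'K] out_ra clo_ra cell_ra]] := cell_pivot a3.
have [rb [[rb' rbK rb'K] out_rb clo_rb cell_rb]] := cell_pivot b3.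
pose f ca cb (w : G * 'I_7) :=
  (w.1, if w.1 == i then ca w.2 else if w.1 == j then cb w.2 else w.2)
  : G * 'I_7.
exists (f ra rb); split.
  by exists (f ra' rb') => -[p x]; rewrite /f /=; case: (p == i);
    case: (p == j); rewrite ?raK ?rbK ?ra'K ?rb'K.
move=> [p x] [q y]; rewrite elcE; last by rewrite adj_expansion iNj ij a3 b3.
have fE r z : f ra rb (r, z) =
  (r, if r == i then ra z else if r == j then rb z else z) by [].
rewrite !fE !closed_nbr_expansion // !adj_expansion elcE // /closed_nbr.
have [->|pi] := eqVneq p i; [|have [->|pj] := eqVneq p j];
  (have [->|qi] := eqVneq q i; [|have [->|qj] := eqVneq q j]);
  rewrite ?(eqxx, iNj, jNi, adj_irr, ij, ji) /= ?(addbF, andbF)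
    ?(clo_ra, clo_rb, out_ra, out_rb, cell_ra, cell_rb).
all: rewrite ?[i == q]eq_sym ?[j == q]eq_sym ?(negPf qi) ?(negPf qj)
  ?(negPf pi) ?(negPf pj) ?(@adj_sym G p i) ?(@adj_sym G p j).
all: by cell_leaves.
Qed.

(** * Degrees in expansions, and edge local complementation *)

Lemma card_ordE n (p : pred nat) : #|[set i : 'I_n | p i]| = count p (iota 0 n).
Proof.
rewrite cardsE -sum1_card -(big_mkord p (fun=> 1%N)) sum1_count.
by rewrite /index_iota subn0.
Qed.

Lemma card_nbrs_expansion (G : sgraph) (p : G) (x : 'I_7) :
  #|@nbrs (hamming_expansion G) (p, x)| =
    ((outer x) * #|nbrs p| * 3 + count (cell_rel x) (iota 0 7))%N.
Proof.
pose S : {set G * 'I_7} :=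
  setX (if outer x then nbrs p else set0) [set k : 'I_7 | outer k].
pose T : {set G * 'I_7} := setX [set p] [set k : 'I_7 | cell_rel x k].
transitivity #|S :|: T|.
  apply: eq_card => -[q k]; rewrite !inE adj_expansion [p == q]eq_sym.
  by have [->|_] := eqVneq q p; case: (outer x);
    rewrite ?inE ?adj_irr ?addbF ?andbF ?orbF.
rewrite (cardsU S T) disjoint_setI0 ?cards0 ?subn0; last first.
  rewrite -setI_eq0; apply/eqP/setP=> -[q k]; rewrite !inE.
  by case: eqVneq => [->|_]; case: (outer x); rewrite ?inE ?adj_irr ?andbF.
rewrite !cardsX cards1 mul1n !card_ordE; congr (_ + _)%N.
by case: (outer x); rewrite ?cards0 ?mul1n.
Qed.

Lemma cell_rel_middle (x y : 'I_7) : cell_rel x y -> middle x || middle y.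
Proof.
apply: implyP; move: x y.
exact: (@all_ord2P 7 (fun x y => cell_rel x y ==> middle x || middle y)).
Qed.

Lemma card_nbrs_middle (G : sgraph) (p : G) (x : 'I_7) :
  middle x -> #|@nbrs (hamming_expansion G) (p, x)| = 3%N.
Proof.
rewrite card_nbrs_expansion => /andP[x2 x6].
rewrite /outer ltnNge x2 mul0n add0n; apply/eqP.
have := implyP _ (introT andP (conj x2 x6)); apply; move: x {x2 x6}.
exact: (@all_ordP 7 (fun x =>
  middle x ==> (count (cell_rel x) (iota 0 7) == 3)))%N.
Qed.

Lemma card_nbrs_expansion_gt1 (G : sgraph) (w : hamming_expansion G) :
  (1 < #|nbrs w|)%N.
Proof.
case: w => p x; rewrite card_nbrs_expansion; apply: ltn_addl; move: x.
exact: (@all_ordP 7 (fun x => 1 < count (cell_rel x) (iota 0 7)))%N.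
Qed.

(** An edge with a middle end is settled by [elc_iso_degree3]; the others join the
    outer vertices of two cells. *)
Lemma expansion_elc_preserved (G : sgraph) :
  orthogonal_graph G -> elc_preserved G ->
  elc_preserved (hamming_expansion G).
Proof.
move=> orthG elcG w z wz.
have orthH := expansion_orthogonal orthG.
have [/card_nbrs_middle z3|zN] := boolP (middle z.2).
  by apply: elc_iso_degree3 => //; case: z wz z3 => q y _ ->.
have [/card_nbrs_middle w3|wN] := boolP (middle w.2).
  apply: graph_iso_trans (elc_sym wz) _; apply: elc_iso_degree3 => //.
    by rewrite adj_sym.
  by case: w wz w3 => q y _ ->.
case: w z wz wN zN => [p x] [q y]; rewrite adj_expansion /=.
have [<-|_] /= := eqVneq p q.
  by rewrite adj_irr addbF => /cell_rel_middle/orP[->|->].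
case/and3P=> pq x3 y3 _ _.
apply: graph_iso_trans (elc_expansion_outer pq x3 y3) _.
exact/expansion_iso/elcG.
Qed.

(** * The starting graphs *)

Lemma graph_of_edges_orthogonal n s :
  all (fun x => all (fun y =>
      foldr (fun k => addb (edge_in s x k && edge_in s k y)) false (iota 0 n)
        == (x == y)) (iota 0 n)) (iota 0 n) ->
  orthogonal_graph (graph_of_edges n s).
Proof.
move=> sP x y; rewrite (xor_ord n (fun k => edge_in s x k && edge_in s k y)).
exact/eqP/(all_ord2P sP).
Qed.

Lemma card_nbrs_of_edges n s (v : 'I_n) :
  #|@nbrs (graph_of_edges n s) v| = count (edge_in s v) (iota 0 n).
Proof. exact: (card_ordE n (edge_in s v)). Qed.

Lemma h3e_orthogonal : orthogonal_graph h3e.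
Proof. exact: graph_of_edges_orthogonal. Qed.

Lemma h3e_elc_preserved : elc_preserved h3e.
Proof.
move=> u v uv; apply: elc_iso_degree3 uv _; first exact: h3e_orthogonal.
rewrite [LHS]card_nbrs_of_edges; set s := (X in edge_in X); apply/eqP; move: v.
exact: (@all_ordP 8 (fun v => count (edge_in s v) (iota 0 8) == 3%N)).
Qed.

Lemma h3e_bipartite : bipartite h3e.
Proof.
exists [set i : 'I_8 | (i < 4)%N] => x y; rewrite !inE; apply/implyP.
move: x y.
rewrite /h3e; set s := [:: _ & _].
exact: (@all_ord2P 8 (fun x y => edge_in s x y ==> ((x < 4) != (y < 4))%N)).
Qed.

Lemma s2_adjE (x y : s2) : adj x y = (x != y).
Proof.
apply/eqP; move: x y.
exact: (@all_ord2P 2 (fun x y => edge_in [:: (0, 1)]%N x y == (x != y))).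
Qed.

Lemma s2_orthogonal : orthogonal_graph s2.
Proof. exact: graph_of_edges_orthogonal. Qed.

Lemma s2_elc_preserved : elc_preserved s2.
Proof.
move=> u v uv; exists id; split; first by exists id.
move=> x y; rewrite elcE // /closed_nbr !s2_adjE.
by rewrite ![u == _]eq_sym ![v == _]eq_sym !orbN !addbT negbK.
Qed.

Lemma s2_bipartite : bipartite s2.
Proof.
exists [set i : 'I_2 | i == ord0] => x y; rewrite !inE; apply/implyP.
move: x y.
exact: (@all_ord2P 2 (fun x y =>
  edge_in [:: (0, 1)]%N x y ==> ((x == 0) != (y == 0))%N)).
Qed.

(** * Bipartite graphs as matrices over the field with two elements *)

Lemma F2_bool (x : 'F_2) : x = (x == 1)%:R.
Proof. by case: x => -[|[|//]] ?; apply/val_inj. Qed.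

Lemma F2_neq0 (x : 'F_2) : (x != 0) = (x == 1).
Proof. by case: x => -[|[|//]] ?. Qed.

Lemma F2_addrr (V : lmodType 'F_2) (v : V) : v + v = 0.
Proof.
by rewrite -[v]scale1r -scalerDl (_ : 1 + 1 = 0) ?scale0r //; apply/val_inj.
Qed.

Lemma F2_natr (n : nat) : n%:R = (odd n)%:R :> 'F_2.
Proof.
elim: n => // n IHn; rewrite [LHS]mulrSr IHn /=.
by case: (odd n); apply/val_inj.
Qed.

Lemma F2_natr_xor (I : finType) (f : pred I) :
  (\big[addb/false]_i f i)%:R = \sum_i (f i)%:R :> 'F_2.
Proof.
apply: (big_morph (fun b : bool => b%:R)) => //.
by case; case; apply/val_inj.
Qed.

Lemma bipartite_bip_graph (G : sgraph) : bipartite G ->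
  exists k m (P : 'M['F_2]_(k, m)),
    (k + m = #|G|)%N /\ graph_iso G (bip_graph P).
Proof.
case=> A bipA.
pose P : 'M['F_2]_(#|A|, #|~: A|) :=
  \matrix_(i, j) (adj (enum_val i) (enum_val j))%:R.
exists #|A|, #|~: A|, P; split; first exact: cardsC.
pose g (l : 'I_(#|A| + #|~: A|)) : G :=
  match split l with inl i => enum_val i | inr j => enum_val j end.
have gl i : g (lshift _ i) = enum_val i.
  by rewrite /g -/(unsplit (inl i)) unsplitK.
have gr j : g (rshift _ j) = enum_val j.
  by rewrite /g -/(unsplit (inr j)) unsplitK.
have lA i : g (lshift _ i) \in A by rewrite gl enum_valP.
have rA j : g (rshift _ j) \in A = false.
  by apply/negbTE; rewrite -in_setC gr enum_valP.
have g_inj : injective g.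
  move=> l l'; case: (split_ordP l) => i ->; case: (split_ordP l') => i' ->.
  - by rewrite !gl => /enum_val_inj->.
  - by move/(congr1 (mem A)); rewrite /= lA rA.
  - by move/(congr1 (mem A)); rewrite /= lA rA.
  - by rewrite !gr => /enum_val_inj->.
apply: graph_iso_sym; exists g; split.
  by apply: inj_card_bij => //; rewrite card_ord cardsC.
have in_part x y : (x \in A) = (y \in A) -> adj x y = false.
  by move=> xy; apply: contraTF isT => /bipA; rewrite xy eqxx.
have bool_eq1 (b : bool) : (b%:R == 1 :> 'F_2) = b by case: b.
move=> l l'; rewrite /= /bip_rel /bip_mx.
case: (split_ordP l) => i ->; case: (split_ordP l') => i' ->.
- by rewrite block_mxEul mxE in_part ?lA.
- by rewrite block_mxEur mxE bool_eq1 gl gr.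
- by rewrite block_mxEdl !mxE bool_eq1 gl gr adj_sym.
- by rewrite block_mxEdr mxE in_part ?rA.
Qed.

Lemma orthogonal_iso (G K : sgraph) :
  graph_iso G K -> orthogonal_graph G -> orthogonal_graph K.
Proof.
case/graph_iso_sym=> f [bijf fadj] orthG x y.
rewrite -(bij_eq bijf) -orthG (reindex f) /=; last exact: onW_bij.
by apply: eq_bigr => z _; rewrite !fadj.
Qed.

Lemma card_nbrs_iso (G K : sgraph) (f : G -> K) (v : G) :
    bijective f -> (forall x y, adj (f x) (f y) = adj x y) ->
  #|nbrs (f v)| = #|nbrs v|.
Proof.
move=> bijf fadj; rewrite -(card_imset _ (bij_inj bijf)).
congr #|pred_of_set _|; apply/setP=> y; have [g fK gK] := bijf.
by rewrite -[y]gK (mem_imset _ _ (bij_inj bijf)) !inE fadj.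
Qed.

Lemma orthogonal_bip_mx k m (P : 'M['F_2]_(k, m)) :
  orthogonal_graph (bip_graph P) -> P *m P^T = 1%:M /\ P^T *m P = 1%:M.
Proof.
move=> orthP; suff: bip_mx P *m bip_mx P = 1%:M.
  rewrite mulmx_block !mulmx0 !mul0mx !addr0 !add0r scalar_mx_block.
  by case/eq_block_mx.
apply/matrixP=> i j; rewrite !mxE -orthP F2_natr_xor.
apply: eq_bigr => l _; rewrite [bip_mx P i l]F2_bool [bip_mx P l j]F2_bool.
by rewrite -natrM mulnb.
Qed.

(** * Weights of binary words *)

Definition weight n (x : 'rV['F_2]_n) : nat := (\sum_i (x 0 i != 0)%R)%N.

Lemma hamming_distE n (x y : 'rV['F_2]_n) : hamming_dist x y = weight (x - y).
Proof.
rewrite /hamming_dist -sum1dep_card big_mkcond; apply: eq_bigr => i _.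
by rewrite !mxE subr_eq0; case: eqP.
Qed.

Lemma weight_eq0 n (x : 'rV['F_2]_n) : (weight x == 0%N) = (x == 0).
Proof.
rewrite sum_nat_eq0; apply/forallP/eqP => [x0|-> i]; last by rewrite mxE eqxx.
apply/rowP=> i; apply/eqP; rewrite mxE; apply/negPn.
by have := x0 i; rewrite eqb0.
Qed.

Lemma weight_row_mx m n (x : 'rV['F_2]_m) (y : 'rV['F_2]_n) :
  weight (row_mx x y) = (weight x + weight y)%N.
Proof.
rewrite /weight big_split_ord.
by congr addn; apply: eq_bigr => i _; rewrite ?row_mxEl ?row_mxEr.
Qed.

Lemma weight_delta n (i : 'I_n) : weight (delta_mx 0 i) = 1%N.
Proof.
rewrite /weight (bigD1 i) //= big1 => [|j /negPf jNi];
  by rewrite mxE ?jNi ?eqxx.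
Qed.

Lemma weight1_delta n (x : 'rV['F_2]_n) :
  weight x = 1%N -> exists i, x = delta_mx 0 i.
Proof.
move=> x1; have [i xi] : exists i, x 0 i != 0.
  apply/existsP; apply: contra_eqT x1 => /existsPn xi.
  by rewrite /weight big1 // => i _; rewrite (negPf (xi i)).
exists i; apply/rowP=> j; rewrite mxE eqxx /= [LHS]F2_bool -F2_neq0.
congr (_%:R).
move: x1; rewrite /weight (bigD1 i) //= xi => -[] /eqP.
rewrite sum_nat_eq0 => /forallP/(_ j).
by have [->|_] /= := eqVneq j i; [rewrite xi | move/eqP].
Qed.

Lemma weight_natr n (x : 'rV['F_2]_n) :
  (weight x)%:R = (x *m x^T) 0 0.
Proof.
rewrite natr_sum mxE; apply: eq_bigr => i _; rewrite mxE F2_neq0.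
by rewrite [in RHS](F2_bool (x 0 i)) -natrM mulnb andbb.
Qed.

(** * The code generated by a systematic matrix *)

Definition systematic_mx (k : nat) (P : 'M['F_2]_k) :
    'M['F_2]_(k, k + k) :=
  row_mx 1%:M P.

Definition systematic_code (k : nat) (P : 'M['F_2]_k) : code (k + k) :=
  limg (linfun (mulmxr (systematic_mx P))).

Lemma mem_systematic_code (k : nat) (P : 'M['F_2]_k) (x : 'rV_(k + k)) :
  reflect (exists a, x = row_mx a (a *m P)) (x \in systematic_code P).
Proof.
apply: (iffP memv_imgP) => [[a _ ->]|[a ->]]; exists a; rewrite ?memvf //;
  by rewrite lfunE /= mul_mx_row mulmx1.
Qed.

Lemma systematic_code_generator (k : nat) (P : 'M['F_2]_k) :
  generator_matrix (systematic_mx P) (systematic_code P).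
Proof.
split.
  apply/row_freeP; exists (col_mx 1%:M 0).
  by rewrite mul_row_col mulmx1 mulmx0 addr0.
move=> x; apply/mem_systematic_code/submxP => -[a ->]; exists a;
  by rewrite mul_mx_row mulmx1.
Qed.

Lemma dim_systematic_code (k : nat) (P : 'M['F_2]_k) :
  \dim (systematic_code P) = k.
Proof.
rewrite limg_dim_eq ?dimvf ?dim_matrix; first exact: mul1n.
apply/eqP; rewrite -subv0; apply/subvP=> a.
rewrite memv_cap memv_ker lfunE /= memv0.
by case/andP=> _; rewrite mul_mx_row mulmx1 -row_mx0 => /eqP/eq_row_mx[-> _].
Qed.

Lemma systematic_code_orthogonal (k : nat) (P : 'M['F_2]_k)
    (x y : 'rV_(k + k)) :
  P *m P^T = 1%:M ->
  x \in systematic_code P -> y \in systematic_code P -> x *m y^T = 0.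
Proof.
move=> PPt /mem_systematic_code[a ->] /mem_systematic_code[b ->].
rewrite tr_row_mx mul_row_col trmx_mul mulmxA -[a *m P *m _]mulmxA PPt mulmx1.
exact: F2_addrr.
Qed.

(** If [x = (a, b)] is orthogonal to the rows of [(1 | P)], then [a = b P^T], hence
    [b = a P] since [P^T] is the inverse of [P]. *)
Lemma systematic_code_self_dual (k : nat) (P : 'M['F_2]_k) :
  P *m P^T = 1%:M ->
  self_dual (systematic_code P).
Proof.
move=> PPt; have inner (x y : 'rV['F_2]_(k + k)) :
    \sum_i x 0 i * y 0 i = (x *m y^T) 0 0.
  by rewrite mxE; apply: eq_bigr => i _; rewrite mxE.
move=> x; rewrite inE; apply/idP/forallP => [Cx y|xC].
  apply/implyP=> Cy.
  by rewrite inner (systematic_code_orthogonal PPt Cx Cy) mxE.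
have xA : x *m (systematic_mx P)^T = 0.
  apply/rowP=> i; rewrite [RHS]mxE; apply/eqP.
  have /implyP := xC (row i (systematic_mx P)); rewrite inner.
  rewrite (_ : (x *m _) 0 0 = (x *m (systematic_mx P)^T) 0 i).
    by apply; rewrite (systematic_code_generator P).2 row_sub.
  by rewrite !mxE; apply: eq_bigr => l _; rewrite !mxE.
apply/mem_systematic_code; exists (lsubmx x).
rewrite -[LHS]hsubmxK; congr row_mx.
move: xA; rewrite -{1}[x]hsubmxK tr_row_mx mul_row_col trmx1 mulmx1 => xA.
have -> : lsubmx x = rsubmx x *m P^T.
  by rewrite -[LHS]addr0 -(F2_addrr (rsubmx x *m P^T)) addrA xA add0r.
by rewrite -mulmxA (mulmx1C PPt) mulmx1.
Qed.

Lemma systematic_code_even (k : nat) (P : 'M['F_2]_k) (x : 'rV_(k + k)) :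
  P *m P^T = 1%:M ->
  x \in systematic_code P -> ~~ odd (weight x).
Proof.
move=> PPt Cx; have := F2_natr (weight x).
rewrite weight_natr (systematic_code_orthogonal PPt Cx Cx) mxE.
by case: (odd _) => // /(congr1 val).
Qed.

(** The weight is even, and both halves of a nonzero word [(a, a P)] are nonzero.
    Weight 2 would therefore mean that [a] and [a P] are unit vectors, the
    latter being a row of [P]. *)
Lemma systematic_code_weight_ge4 (k : nat) (P : 'M['F_2]_k) (x : 'rV_(k + k)) :
  P *m P^T = 1%:M ->
  (forall i, weight (row i P) != 1%N) ->
  x \in systematic_code P -> x != 0 -> (4 <= weight x)%N.
Proof.
move=> PPt rowP Cx x0; have := systematic_code_even PPt Cx.
case/mem_systematic_code: Cx x0 => a ->; rewrite weight_row_mx => x0.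
have a0 : a != 0 by apply: contraNneq x0 => ->; rewrite mul0mx row_mx0.
have aP0 : a *m P != 0.
  apply: contraNneq a0 => /(congr1 (mulmx^~ P^T)).
  by rewrite -mulmxA PPt mulmx1 mul0mx => ->.
have wt2 : weight a = 1%N -> weight (a *m P) != 1%N.
  by case/weight1_delta=> i ->; rewrite -rowE.
move: a0 aP0 wt2; rewrite -!weight_eq0.
by case: (weight a) => [|[|[|[|wa]]]] //;
  case: (weight _) => [|[|[|[|wb]]]] //= _ _ /(_ erefl).
Qed.

Lemma systematic_code_min_distance (k : nat) (P : 'M['F_2]_k)
    (w : 'rV_(k + k)) :
  P *m P^T = 1%:M ->
  (forall i, weight (row i P) != 1%N) ->
  w \in systematic_code P -> weight w = 4%N ->
  min_distance (systematic_code P) 4.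
Proof.
move=> PPt rowP Cw w4; split.
  by exists w, 0; rewrite Cw mem0v hamming_distE subr0 w4 -weight_eq0 w4.
move=> x y Cx Cy xy; rewrite hamming_distE (systematic_code_weight_ge4 PPt) //.
  exact: memvB.
by rewrite subr_eq0.
Qed.

(** * From graphs to codes *)

Lemma card_nbrs_lshift k m (P : 'M['F_2]_(k, m)) (i : 'I_k) :
  #|@nbrs (bip_graph P) (lshift m i)| = weight (row i P).
Proof.
rewrite /nbrs -sum1dep_card big_mkcond big_split_ord /= big1 ?add0n => [|j _].
  apply: eq_bigr => j _; rewrite /bip_rel /bip_mx block_mxEur !mxE F2_neq0.
  by case: (_ == 1).
by rewrite /bip_rel /bip_mx block_mxEul mxE.
Qed.

Lemma card_nbrs_rshift k m (P : 'M['F_2]_(k, m)) (j : 'I_m) :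
  #|@nbrs (bip_graph P) (rshift k j)| = weight (row j P^T).
Proof.
rewrite /nbrs -sum1dep_card big_mkcond big_split_ord /=.
rewrite [X in (_ + X)%N]big1 ?addn0 => [|i _].
  apply: eq_bigr => i _; rewrite /bip_rel /bip_mx block_mxEdl !mxE F2_neq0.
  by case: (_ == 1).
by rewrite /bip_rel /bip_mx block_mxEdr mxE.
Qed.

(** The closed neighbourhood of [v] is the codeword of weight 4.  If [v] lies on the
    side of the rows it is a row of [(1 | P)]; otherwise it is the sum of the
    rows of the neighbours of [v]. *)
Lemma self_dual_code_of_graph (G : sgraph) (n k : nat) (v : G) :
    bipartite G -> orthogonal_graph G -> elc_preserved G ->
    (forall x : G, 1 < #|nbrs x|)%N -> #|nbrs v| = 3%N ->
    #|G| = n -> n = (k + k)%N ->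
  exists C : code n,
    [/\ nkd_code k 4 C, self_dual C, elc_preserved_code C & corresponds G C].
Proof.
move=> bipG orthG elcG deg_gt1 deg3 cardG n2k.
have [l [m [P [lm isoG]]]] := bipartite_bip_graph bipG.
have [PPt PtP] := orthogonal_bip_mx (orthogonal_iso isoG orthG).
have ml : m = l by apply/eqP; rewrite eqn_leq (mulmx1_min PPt) (mulmx1_min PtP).
have lk : l = k by apply: double_inj; rewrite -!addnn -n2k -cardG -lm ml.
clear cardG lm; subst m l n.
have [f [bijf fadj]] := isoG.
have rowP i : weight (row i P) != 1%N.
  have [f' fK f'K] := bijf.
  rewrite -card_nbrs_lshift -[lshift _ i]f'K (card_nbrs_iso _ bijf fadj).
  by rewrite gtn_eqF.
have [w Cw w4] : exists2 w, w \in systematic_code P & weight w = 4%N.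
  have : #|nbrs (f v)| = 3%N by rewrite (card_nbrs_iso _ bijf fadj).
  case: (split_ordP (f v)) => i ->;
    rewrite ?card_nbrs_lshift ?card_nbrs_rshift => wi.
    exists (row_mx (delta_mx 0 i) (row i P)).
      by apply/mem_systematic_code; exists (delta_mx 0 i); rewrite rowE.
    by rewrite weight_row_mx weight_delta wi.
  exists (row_mx (row i P^T) (delta_mx 0 i)).
    apply/mem_systematic_code; exists (row i P^T).
    by rewrite rowE -mulmxA PtP mulmx1.
  by rewrite weight_row_mx weight_delta wi.
have corrG : corresponds G (systematic_code P).
  split=> //; exists k, k, erefl, P, (systematic_code P); split=> //.
    by exists 1%g => x; rewrite col_perm1.
  by rewrite castmx_id; apply: systematic_code_generator.
exists (systematic_code P); split=> //.
- split; first exact: dim_systematic_code.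
  exact: systematic_code_min_distance Cw w4.
- exact: systematic_code_self_dual.
by exists G.
Qed.

(** * Iterated expansions *)

Definition self_dual_elc_graph (G : sgraph) : Prop :=
  [/\ bipartite G, orthogonal_graph G & elc_preserved G].

Lemma expansion_self_dual_elc (G : sgraph) :
  self_dual_elc_graph G -> self_dual_elc_graph (hamming_expansion G).
Proof.
case=> bipG orthG elcG; split.
- exact: expansion_bipartite.
- exact: expansion_orthogonal.
- exact: expansion_elc_preserved.
Qed.

Lemma iter_expansion_self_dual_elc (G : sgraph) (r : nat) :
  self_dual_elc_graph G -> self_dual_elc_graph (iter r hamming_expansion G).
Proof. by move=> GP; elim: r => //= r; apply: expansion_self_dual_elc. Qed.

Lemma card_iter_expansion (G : sgraph) (r : nat) :
  #|iter r hamming_expansion G| = (#|G| * 7 ^ r)%N.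
Proof.
elim: r => [|r IHr]; first by rewrite muln1.
by rewrite iterS card_prod card_ord IHr expnSr mulnA.
Qed.

Lemma iter_expansion_code (G : sgraph) (k r : nat) :
    self_dual_elc_graph G -> #|G| = k.*2 -> (0 < k)%N ->
  exists C : code (k.*2 * 7 ^ r.+1),
    [/\ nkd_code (k * 7 ^ r.+1) 4 C, self_dual C, elc_preserved_code C
      & corresponds (iter r.+1 hamming_expansion G) C].
Proof.
move=> GP cardG k0.
have [bipH orthH elcH] := iter_expansion_self_dual_elc r.+1 GP.
have /card_gt0P[p _] : (0 < #|iter r hamming_expansion G|)%N.
  by rewrite card_iter_expansion cardG muln_gt0 double_gt0 k0 expn_gt0.
have deg_gt1 := @card_nbrs_expansion_gt1 (iter r hamming_expansion G).
pose v : iter r.+1 hamming_expansion G := (p, inord 3).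
apply: (@self_dual_code_of_graph _ _ _ v) => //.
- by apply: card_nbrs_middle; rewrite inordK.
- by rewrite card_iter_expansion cardG.
by rewrite -doubleMl addnn.
Qed.

Theorem theorem13 (r : nat) (hr : (1 <= r)%N) :
  (exists C : code (8 * 7 ^ r),
     [/\ nkd_code (4 * 7 ^ r) 4 C,
         self_dual C,
         elc_preserved_code C
       & corresponds (iter r hamming_expansion h3e) C]) /\
  (exists C : code (2 * 7 ^ r.+1),
     [/\ nkd_code (7 ^ r.+1) 4 C,
         self_dual C,
         elc_preserved_code C
       & corresponds (iter r.+1 hamming_expansion s2) C]).
Proof.
have h3eP : self_dual_elc_graph h3e.
  split; [exact: h3e_bipartite|exact: h3e_orthogonal|exact: h3e_elc_preserved].
have s2P : self_dual_elc_graph s2.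
  split; [exact: s2_bipartite|exact: s2_orthogonal|exact: s2_elc_preserved].
split.
  case: r hr => // r _.
  by apply: (@iter_expansion_code h3e 4) => //; rewrite card_ord.
have := @iter_expansion_code s2 1 r s2P (card_ord 2) isT.
by rewrite mul1n.
Qed.
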